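(* Let $\mathbb K$ be a field and $R:=\mathbb K[x_0,\ldots,x_n]$. Let $s\geq n+1$ and let $\mathcal A=\{H_1,\ldots,H_s\}$ be a generic collection of hyperplanes in $\mathbb P^n$, with $H_i=V(\ell_i)$ for linear forms $\ell_1,\ldots,\ell_s\in R$. Let $1\leq c\leq n$, and let $I:=I(V_c(\mathcal A,\mathbb P^n))$ be the defining ideal of the star configuration of codimension $c$ with support in $\mathcal A$. Then $$\rho(I)=\frac{c(s-c+1)}{s}.$$
   Context: The collection $\mathcal A$ is generic if any $n+1$ of the linear forms $\ell_1,\ldots,\ell_s$ are linearly independent. For $1\le c\le n$, the star configuration of codimension $c$ with support $\mathcal A$ is $V_c(\mathcal A,\mathbb P^n)=\bigcup_{1\leq j_1<\cdots<j_c\leq s}H_{j_1}\cap\cdots\cap H_{j_c}$. Its defining ideal is $$I(V_c(\mathcal A,\mathbb P^n))=\bigcap_{1\leq j_1<\cdots<j_c\leq s}\langle \ell_{j_1},\ldots,\ell_{j_c}\rangle,$$ and for $m\geq 1$ the $m$-th symbolic power of this ideal $I$ is $$I^{(m)}=\bigcap_{1\leq j_1<\cdots<j_c\leq s}\langle \ell_{j_1},\ldots,\ell_{j_c}\rangle^m.$$ The resurgence of $I$ is $$\rho(I):=\sup\left\{\frac{m}{r}\,\Big|\, m,r\ge 1 \text{ integers with } I^{(m)}\nsubseteq I^r\right\}.$$ *)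

(* Defs.v *)
From mathcomp Require Import all_boot all_order all_algebra.
From mathcomp Require Import classical_sets reals constructive_ereal ereal.
(* The notations of mpoly and of mathcomp.classical have incompatible levels;
   [mpoly n K] is the type {mpoly K[n]}. *)
From mathcomp.multinomials Require Import -(notations) mpoly.

Set Implicit Arguments.
Unset Strict Implicit.
Unset Printing Implicit Defensive.

Local Open Scope classical_set_scope.
Local Open Scope ring_scope.

Section Ideals.
Variable A : comNzRingType.

Definition ideal_span (S : set A) : set A :=
  [set x | exists k (a g : 'I_k -> A),
     (forall i, S (g i)) /\ x = \sum_(i < k) a i * g i].

Definition ideal_pow (I : set A) (m : nat) : set A :=
  ideal_span [set x | exists g : 'I_m -> A,
     (forall i, I (g i)) /\ x = \prod_(i < m) g i].

(* [symb m] plays the role of the symbolic power I^(m).  The supremum is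
   taken in the extended reals, so no boundedness is presupposed. *)
Definition resurgence (R : realType) (I : set A) (symb : nat -> set A) :
    \bar R :=
  ereal_sup [set x | exists m r : nat,
     [/\ (1 <= m)%N, (1 <= r)%N, ~ (symb m `<=` ideal_pow I r)
       & x = (m%:R / r%:R)%:E]].

End Ideals.

Section StarConfigurations.
(* [dhomog n.+1 K 1] is the K-vector space of linear forms in K[x_0,...,x_n];
   the hyperplane H_i of P^n is the zero locus of [l i]. *)
Variables (K : fieldType) (n s : nat) (l : 'I_s -> dhomog n.+1 K 1).

Definition generic_forms : Prop :=
  forall J : {set 'I_s}, #|J| = n.+1 -> free [seq l j | j <- enum J].

Definition forms_ideal (J : {set 'I_s}) : set (mpoly n.+1 K) :=
  ideal_span [set mpoly_of_dhomog (l j) | j in [set j | j \in J]].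

Definition star_ideal (c : nat) : set (mpoly n.+1 K) :=
  \bigcap_(J in [set J : {set 'I_s} | #|J| = c]) forms_ideal J.

Definition star_symbolic_power (c m : nat) : set (mpoly n.+1 K) :=
  \bigcap_(J in [set J : {set 'I_s} | #|J| = c]) ideal_pow (forms_ideal J) m.

Definition star_resurgence (R : realType) (c : nat) : \bar R :=
  resurgence R (star_ideal c) (star_symbolic_power c).

End StarConfigurations.

Arguments star_resurgence {K n s} l R c.

(* Main.v *)
Require Import Defs.
From mathcomp Require Import all_boot all_order all_algebra.
From mathcomp Require Import classical_sets reals constructive_ereal ereal.
From mathcomp.multinomials Require Import -(notations) mpoly.
From mathcomp Require Import zify.

(** Write [L^a] for the product of the forms [l_i ^ a_i] and [a(J)] for the
    sum of the exponents [a_i], [i] in [J].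

    The core of the proof is that a symbolic power is generated by the obvious
    products: [I^(m)], the intersection of the ideals [(l_J)^m] over the sets
    [J] of [c] indices, is generated by the [L^a] such that [a(J) >= m] for
    all these [J] (lemma [star_symbolic_power_gen]).  This is proved by peeling
    off hyperplanes, in the more general form [gen_star], where the exponent
    [m - b(J)] may depend on [J] through a weight [b].  Let [f] be in the
    intersection, and choose [i] with [b_i] minimal.  Modulo [l_i], [f]
    satisfies the same conditions for sets of size [c - 1] and exponent
    [m - b_i], so by induction on [c] it is there a combination of products,
    and minimality of [b_i] ensures that these products satisfy the original
    conditions.  Hence [f = h + l_i g] for a combination [h] of such products,
    and [g] satisfies the conditions for [b] increased by one at [i];
    iterating, [b] becomes so large that the conditions are empty.  The passage
    from [l_i g] to [g] only needs that [l_i] acts on [(l_J)^k + (l_T)] as a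
    variable acts on an ideal generated by monomials, which is the case because
    any [n + 1] generic forms are a system of linear coordinates (lemma
    [generic_regular]).

    Put [d = s - c + 1].  For the upper bound, a product of [d] distinct forms
    lies in [I], because [d] indices meet every set of [c] indices; and [L^a]
    is divisible by a product of [r] such products as soon as
    [sum_i min(a_i, r) >= r d] (lemma [lpow_ideal_pow]).  An averaging argument
    shows that this holds for all [a] with [a(J) >= m] if [m s >= r c d]
    (lemma [symbolic_exponent_bound]).  So [I^(m)] is contained in [I^r]
    whenever [m / r >= c d / s].

    For the lower bound, the case [m = 1] of the generation result shows that
    all terms of elements of [I] have degree at least [d], so those of [I^r]
    have degree at least [r d].  But [(l_1 ... l_s)^k] has degree [k s] and
    lies in [I^(c k)].  Hence [I^(c k)] is not contained in [I^r] if
    [k s < r d], and the ratios [c k / r] approach [c d / s]. *)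

Set Implicit Arguments.
Unset Strict Implicit.
Unset Printing Implicit Defensive.

Import Order.TTheory GRing.Theory Num.Theory.

Local Open Scope ring_scope.

(** * Ideals spanned by a set *)

Section Ideals.
Variable A : comNzRingType.
Implicit Types (S : set A) (x y z : A).

Lemma ideal_span0 S : ideal_span S 0.
Proof.
exists 0%N, (fun _ => 0), (fun _ => 0); split=> [[] //|].
by rewrite big_ord0.
Qed.

Lemma ideal_spanD S x y :
  ideal_span S x -> ideal_span S y -> ideal_span S (x + y).
Proof.
move=> [k1 [a1 [g1 [Sg1 ->]]]] [k2 [a2 [g2 [Sg2 ->]]]].
pose glue T (u1 : 'I_k1 -> T) (u2 : 'I_k2 -> T) i :=
  match fintype.split i with inl j => u1 j | inr j => u2 j end.
exists (k1 + k2)%N, (glue _ a1 a2), (glue _ g1 g2); split.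
  by rewrite /glue => i; case: (fintype.split i).
rewrite big_split_ord /=; congr (_ + _); apply: eq_bigr => i _.
  by rewrite /glue (unsplitK (inl i)).
by rewrite /glue (unsplitK (inr i)).
Qed.

Lemma ideal_spanM S x y : ideal_span S y -> ideal_span S (x * y).
Proof.
move=> [k [a [g [Sg ->]]]]; exists k, (fun i => x * a i), g; split=> //.
by rewrite mulr_sumr; apply: eq_bigr => i _; rewrite mulrA.
Qed.

Lemma ideal_span_mem S x : S x -> ideal_span S x.
Proof.
move=> Sx; exists 1%N, (fun _ => 1), (fun _ => x); split=> //.
by rewrite big_ord1 mul1r.
Qed.

Lemma ideal_span_ind S (P : A -> Prop) :
    P 0 -> (forall x y, P x -> P y -> P (x + y)) ->
    (forall x y, S y -> P (x * y)) ->
  forall x, ideal_span S x -> P x.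
Proof.
move=> P0 PD PM x [k [a [g [Sg ->]]]].
by apply: (big_ind P) => // i _; apply: PM.
Qed.

Lemma ideal_span_sum S (J : Type) (r : seq J) (P : pred J) (F : J -> A) :
    (forall j, P j -> ideal_span S (F j)) ->
  ideal_span S (\sum_(j <- r | P j) F j).
Proof.
move=> SF; apply: (big_ind (ideal_span S)) => //; first exact: ideal_span0.
exact: ideal_spanD.
Qed.

Lemma ideal_powS S r x y :
  S x -> ideal_pow S r y -> ideal_pow S r.+1 (x * y).
Proof.
move=> Sx; apply: (ideal_span_ind (P := fun y => ideal_pow S r.+1 (x * y))).
- by rewrite mulr0; apply: ideal_span0.
- by move=> u v; rewrite mulrDr; apply: ideal_spanD.
move=> u _ [g [Sg ->]]; rewrite mulrCA; apply: ideal_spanM.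
apply: ideal_span_mem.
exists (fun i => if unlift ord0 i is Some j then g j else x); split.
  by move=> i; case: unliftP.
rewrite big_ord_recl unlift_none; congr (_ * _).
by apply: eq_bigr => i _; rewrite liftK.
Qed.

Lemma ideal_pow0 S x : ideal_pow S 0 x.
Proof.
rewrite -[x]mulr1; apply: ideal_spanM; apply: ideal_span_mem.
by exists (fun _ => 0); split=> [[] //|]; rewrite big_ord0.
Qed.

End Ideals.

(** * Finite sets *)

Lemma disjoint_setU1 (I : finType) (i : I) (B C : {set I}) :
  [disjoint i |: B & C] = (i \notin C) && [disjoint B & C].
Proof.
rewrite -[[disjoint _ & C]]setI_eq0 finset.setIUl finset.setU_eq0.
by rewrite !setI_eq0 disjoints1.
Qed.

Lemma set_interpolation (I : finType) (B C : {set I}) (d : nat) :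
    B \subset C -> (#|B| <= d <= #|C|)%N ->
  exists2 D : {set I}, B \subset D /\ D \subset C & #|D| = d.
Proof.
move=> BC /andP[]; elim: d => [|d IHd] Bd dC.
  by exists B => //; apply/eqP; rewrite -leqn0.
move: Bd; rewrite leq_eqVlt => /orP[/eqP Bd|Bd]; first by exists B.
have [D [BD DC] cD] := IHd Bd (ltnW dC).
have /properP[_ [i iC iD]] : D \proper C.
  by rewrite properEcard DC cD.
exists (i |: D); last by rewrite cardsU1 iD cD add1n.
split; first exact: fintype.subset_trans BD (finset.subsetUr _ _).
by rewrite finset.subUset finset.sub1set iC.
Qed.

(** * Ideals generated by products of powers *)

Section Products.
Variables (A : comNzRingType) (I : finType) (l : I -> A).
Implicit Types (a b : I -> nat) (J T : {set I}) (Q : (I -> nat) -> Prop).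

Definition weight a J : nat := \sum_(i in J) a i.

Definition lpow a : A := \prod_i l i ^+ a i.

(** The ideal generated by the products with exponent vector in [Q].  All
    ideals of the proof have this form: [(l_J)^k + (l_T)] is given by
    [k <= weight a J \/ 0 < weight a T]. *)
Definition gen Q : set A := ideal_span [set x | exists2 a, Q a & x = lpow a].

Definition one_at (i : I) : I -> nat := fun j => (j == i : nat).

Lemma lpowD a b : lpow (fun i => a i + b i)%N = lpow a * lpow b.
Proof. by rewrite -big_split; apply: eq_bigr => i _; rewrite exprD. Qed.

Lemma lpow_one_at i : lpow (one_at i) = l i.
Proof.
rewrite /lpow (bigD1 i) //= big1 => [|j /negPf ji]; rewrite /one_at ?ji //.
by rewrite eqxx mulr1.
Qed.

Lemma lpow_sub a i : (0 < a i)%N ->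
  lpow a = l i * lpow (fun j => a j - one_at i j)%N.
Proof.
move=> ai; rewrite -[X in X * _]lpow_one_at -lpowD.
apply: eq_bigr => j _; congr (_ ^+ _).
by rewrite /one_at; case: eqP => [->|_] /=; lia.
Qed.

Lemma lpow_set J : lpow (fun i => (i \in J : nat)) = \prod_(i in J) l i.
Proof.
rewrite /lpow [RHS]big_mkcond; apply: eq_bigr => i _.
by case: (i \in J).
Qed.

Lemma weightD a b J :
  weight (fun i => a i + b i)%N J = (weight a J + weight b J)%N.
Proof. exact: big_split. Qed.

Lemma weight_one_at i J : weight (one_at i) J = (i \in J).
Proof.
rewrite /weight; case: (boolP (i \in J)) => iJ.
  rewrite (bigD1 i) //= /one_at eqxx big1 // => j /andP[_ /negPf ->] //.
by rewrite big1 // => j jJ; rewrite /one_at; case: eqP iJ => // <-; rewrite jJ.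
Qed.

Lemma weight_set0 a : weight a finset.set0 = 0%N.
Proof. exact: big_set0. Qed.

Lemma weightD1 a i J : i \in J -> weight a J = (a i + weight a (J :\ i))%N.
Proof. by move=> iJ; rewrite /weight (big_setD1 i). Qed.

Lemma weight_gt0 a J : (0 < weight a J)%N -> exists2 i, i \in J & (0 < a i)%N.
Proof.
rewrite lt0n /weight sum_nat_eq0 => /forallPn[i].
by rewrite negb_imply -lt0n => /andP[iJ ai]; exists i.
Qed.

Lemma gen_lpow Q a : Q a -> gen Q (lpow a).
Proof. by move=> Qa; apply: ideal_span_mem; exists a. Qed.

Lemma gen_ind Q (P : A -> Prop) :
    P 0 -> (forall x y, P x -> P y -> P (x + y)) ->
    (forall x a, Q a -> P (x * lpow a)) ->
  forall x, gen Q x -> P x.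
Proof.
by move=> P0 PD PM; apply: ideal_span_ind => // x _ [a Qa ->]; apply: PM.
Qed.

Lemma gen_sub Q (Q' : (I -> nat) -> Prop) :
  (forall a, Q a -> Q' a) -> (gen Q `<=` gen Q')%classic.
Proof.
move=> QQ'; apply: gen_ind; first exact: ideal_span0.
  by move=> x y; apply: ideal_spanD.
by move=> x a /QQ' Qa; apply: ideal_spanM; apply: gen_lpow.
Qed.

Lemma gen_full Q x : Q (fun _ => 0%N) -> gen Q x.
Proof.
move=> Q0; rewrite -[x]mulr1; apply: ideal_spanM.
suff -> : 1 = lpow (fun _ => 0%N) by apply: gen_lpow.
by rewrite /lpow big1.
Qed.

Lemma genM (Q1 Q2 Q : (I -> nat) -> Prop) x y :
    (forall a b, Q1 a -> Q2 b -> Q (fun i => a i + b i)%N) ->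
  gen Q1 x -> gen Q2 y -> gen Q (x * y).
Proof.
move=> Q12 Q1x Q2y; move: x Q1x; apply: gen_ind.
- by rewrite mul0r; apply: ideal_span0.
- by move=> u v; rewrite mulrDl; apply: ideal_spanD.
move=> u a Qa; rewrite -mulrA; apply: ideal_spanM; move: y Q2y; apply: gen_ind.
- by rewrite mulr0; apply: ideal_span0.
- by move=> v w; rewrite mulrDr; apply: ideal_spanD.
move=> v b Qb; rewrite mulrCA; apply: ideal_spanM; rewrite -lpowD.
by apply: gen_lpow; apply: Q12.
Qed.

(** This replaces reduction modulo [l i]: congruences are carried along as
    additional generators, so that the induction never leaves the ring. *)
Lemma gen_split Q i x : gen (fun a => Q a \/ (0 < a i)%N) x ->
  exists2 y, gen Q y & exists g, x = y + l i * g.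
Proof.
move: x; apply: gen_ind.
- by exists 0; [exact: ideal_span0 | exists 0; rewrite mulr0 addr0].
- move=> x x' [y Qy [g ->]] [y' Qy' [g' ->]]; exists (y + y').
    exact: ideal_spanD.
  by exists (g + g'); rewrite mulrDr addrACA.
move=> x a [Qa|ai].
  exists (x * lpow a); first by apply: ideal_spanM; apply: gen_lpow.
  by exists 0; rewrite mulr0 addr0.
exists 0; first exact: ideal_span0.
exists (x * lpow (fun j => a j - one_at i j)%N).
by rewrite add0r mulrCA -lpow_sub.
Qed.

(** The colon ideals by [l i] of the ideals [(l_J)^k + (l_T)] are what they
    would be if the [l_j] involved were distinct variables.  Besides
    [l i], at most [n] forms are involved at a time. *)
Definition regular_upto (n : nat) : Prop :=
  forall T J i k g, (#|T| + #|J| <= n)%N -> i \notin T ->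
    gen (fun a => (k <= weight a J)%N \/ (0 < weight a T)%N) (l i * g) ->
    gen (fun a => (k <= weight a J + (i \in J))%N \/ (0 < weight a T)%N) g.

(** Intersections of the ideals [(l_J)^(m - b(J)) + (l_T)], [#|J| = c], are
    generated by the products that lie in all of them.  The set [T] collects
    the forms modulo which one has already reduced, and the weight [b] records
    the factors that have already been divided out. *)
Lemma gen_star n c T m b x :
    regular_upto n -> (#|T| + c <= n)%N ->
    (forall J : {set I}, #|J| = c -> [disjoint J & T] ->
       gen (fun a => (m <= weight a J + weight b J)%N \/ (0 < weight a T)%N) x) ->
  gen (fun a => (forall J : {set I}, #|J| = c -> [disjoint J & T] ->
         (m <= weight a J + weight b J)%N) \/ (0 < weight a T)%N) x.
Proof.
move=> reg; elim: c => [|c IHc] in T m b x *.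
  move=> _ /(_ finset.set0 (cards0 _)) xJ.
  apply: gen_sub (xJ _) => [a [am|aT]|]; [left|by right|].
    by move=> J /eqP; rewrite cards_eq0 => /eqP-> _.
  by rewrite -finset.setI_eq0 finset.set0I.
move=> cT; have [N] := ubnP (\sum_(i in ~: T) (m - b i))%N.
elim: N => // N IHN in b x * => leN xJ.
(* If all [b_j >= m], no condition is left and the empty product will do. *)
have [/existsP[i0 /andP[i0T bi0]]|] :=
    boolP [exists i, (i \notin T) && (b i < m)%N]; last first.
  move=> /existsPn bm; apply: gen_full; left => J cJ JT.
  have /card_gt0P[j jJ] : (0 < #|J|)%N by rewrite cJ.
  have := bm j; rewrite (disjointFr JT jJ) /= -leqNgt.
  by rewrite (weightD1 b jJ); lia.
pose i := [arg min_(i < i0 | i \notin T) b i].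
have [iT bi_min] : i \notin T /\ forall j, j \notin T -> (b i <= b j)%N.
  by rewrite /i; case: arg_minnP.
have bim : (b i < m)%N by apply: leq_ltn_trans bi0; apply: bi_min.
(* The conditions for the sets containing [i] are, modulo [l i], those of the
   same problem for [c] and [m - b i]. *)
have xJ' J : #|J| = c -> [disjoint J & i |: T] ->
    gen (fun a => (m - b i <= weight a J + weight b J)%N
                  \/ (0 < weight a (i |: T))%N) x.
  move=> cJ JiT.
  have iJ : i \notin J by rewrite (disjointFl JiT) // finset.setU11.
  apply: gen_sub (xJ (i |: J) _ _) => [a| |]; last 2 first.
  - by rewrite cardsU1 iJ cJ.
  - rewrite disjoint_setU1 iT /=; apply: disjointWr JiT; exact: finset.subsetUr.
  rewrite !(weightD1 _ (finset.setU11 i _)) !finset.setU1K //; lia.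
have /(IHc (i |: T) (m - b i)%N b x) : (#|i |: T| + c <= n)%N.
  by rewrite cardsU1 iT; lia.
move=> /(_ xJ').
set Q' := (X in _ -> gen X x).
pose Q0 a := (forall J : {set I}, #|J| = c -> [disjoint J & i |: T] ->
  (m - b i <= weight a J + weight b J)%N) \/ (0 < weight a T)%N.
move=> Qx; have {Qx} /gen_split[y Q0y [g xE]] :
    gen (fun a => Q0 a \/ (0 < a i)%N) x.
  apply: gen_sub Qx => a [aJ|]; first by left; left.
  rewrite (weightD1 _ (finset.setU11 i _)) finset.setU1K // addn_gt0.
  move=> /orP[]; first by right.
  by left; right.
(* For sets [J] avoiding [i], trade [i] for some [j] in [J]: minimality of
   [b i] makes the condition on [J] weaker than the one on [J :\ j]. *)
have Q'y : gen Q' y.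
  apply: gen_sub Q0y => a [aJ|aT]; [left|by right].
  move=> J cJ JT.
  have JiT j : j \in J -> i \in J :\ j = false ->
      (m - b i <= weight a (J :\ j) + weight b (J :\ j))%N.
    move=> jJ iJ; apply: aJ.
      by have := cardsD1 j J; rewrite jJ cJ add1n => -[].
    rewrite disjoint_sym disjoint_setU1 iJ disjoint_sym /=.
    by apply: disjointWl JT; rewrite finset.subsetDl.
  have [iJ|iJ] := boolP (i \in J).
    have := JiT i iJ; rewrite finset.setD11 => /(_ erefl).
    by rewrite !(weightD1 _ iJ); lia.
  have /card_gt0P[j jJ] : (0 < #|J|)%N by rewrite cJ.
  have := JiT j jJ; rewrite finset.in_setD1 (negPf iJ) andbF => /(_ erefl).
  have := bi_min j; rewrite (disjointFr JT jJ) => /(_ isT).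
  by rewrite !(weightD1 _ jJ); lia.
rewrite {}xE in xJ *; apply: ideal_spanD => //.
(* Dividing by [l i] lowers the exponents for the sets containing [i], which
   amounts to raising [b] by one at [i]. *)
have gJ J : #|J| = c.+1 -> [disjoint J & T] ->
    gen (fun a => (m <= weight a J + weight (fun j => b j + one_at i j) J)%N
                  \/ (0 < weight a T)%N) g.
  move=> cJ JT.
  have ligJ : gen (fun a => (m - weight b J <= weight a J)%N
                            \/ (0 < weight a T)%N) (l i * g).
    have -> : l i * g = (y + l i * g) + (-1) * y by rewrite mulN1r addrC addKr.
    apply: ideal_spanD; first by apply: gen_sub (xJ J cJ JT) => a; lia.
    apply: ideal_spanM; apply: gen_sub Q'y => a [/(_ J cJ JT)|]; lia.
  apply: gen_sub (reg T J i _ g _ iT ligJ); last by rewrite cJ.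
  by move=> a; rewrite weightD weight_one_at; lia.
have /IHN/(_ gJ) : (\sum_(j in ~: T) (m - (b j + one_at i j)) < N)%N.
  rewrite -ltnS; apply: leq_trans leN; rewrite ltnS.
  rewrite (bigD1 i) ?inE //= [ltnRHS](bigD1 i) ?inE //=.
  rewrite /one_at eqxx -addSn; apply: leq_add; first by lia.
  by apply: leq_sum => j _; lia.
apply: (@genM (fun a => (0 < a i)%N)) => [a b' ai|]; last first.
  by rewrite -(lpow_one_at i); apply: gen_lpow; rewrite /one_at eqxx.
move=> [b'J|b'T]; [left|right]; last by rewrite weightD; lia.
move=> J cJ JT; have := b'J J cJ JT; rewrite !weightD weight_one_at.
have [iJ|] := boolP (i \in J); last by lia.
by rewrite (weightD1 a iJ); lia.
Qed.

End Products.

(** * Generic linear forms as coordinates *)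

Section Coordinates.
Variables (K : fieldType) (n : nat).
Local Notation R := (mpoly n.+1 K).
Local Notation var k := (mpolyX K (mnm1 k)).

Lemma linear_form_sum (p : dhomog n.+1 K 1) :
  mpoly_of_dhomog p = \sum_(k < n.+1) mcoeff (mnm1 k) p *: var k.
Proof.
apply/mpolyP => e; rewrite raddf_sum /=.
under eq_bigr do rewrite mcoeffZ mcoeffX.
have [/existsP[k /eqP ->]|e1] := boolP [exists k, e == mnm1 k].
  rewrite (bigD1 k) //= eqxx mulr1 big1 ?addr0 // => j jk.
  by rewrite eq_mnm1 (negPf jk) mulr0.
rewrite big1 => [|k _]; last first.
  by move/existsPn: e1 => /(_ k); rewrite eq_sym => /negPf ->; rewrite mulr0.
by apply: (dhomog_nemf_coeff (dhomog_is_dhomog p)); rewrite /= mdeg_eq1.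
Qed.

(** Independence makes the matrix of coefficients of [n + 1] of the forms
    invertible; its inverse gives the substitution [psi] that turns these forms
    into the variables, and substituting the forms back undoes it. *)
Lemma linear_coordinates s (l : 'I_s -> dhomog n.+1 K 1) (U : {set 'I_s}) :
    generic_forms l -> #|U| = n.+1 ->
  exists (u : 'I_n.+1 -> 'I_s) (psi : {rmorphism R -> R}),
    [/\ injective u, (forall i, (i \in U) = [exists k, u k == i]),
        (forall k, psi (l (u k)) = var k)
      & forall f,
          f = comp_mpoly [tuple mpoly_of_dhomog (l (u k)) | k < n.+1] (psi f)].
Proof.
move=> gen_l cU.
pose u k : 'I_s := enum_val (cast_ord (esym cU) k).
pose M := \matrix_(k, j) mcoeff (mnm1 j) (l (u k)) : 'M[K]_n.+1.
have lM k : mpoly_of_dhomog (l (u k)) = \sum_j M k j *: var j.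
  by rewrite linear_form_sum; apply: eq_bigr => j _; rewrite mxE.
have Minv : M \in unitmx.
  rewrite -row_free_unit; apply: inj_row_free => v vM0.
  have sz : size [seq l j | j <- enum U] == n.+1 by rewrite size_map -cardE cU.
  have /(freeP (X := Tuple sz))/(_ (v 0)) := gen_l U cU.
  have Xu (k : 'I_n.+1) : (Tuple sz)`_k = l (u k).
    rewrite (nth_map (u k)) -?cardE ?cU //.
    by rewrite [u k in RHS]/u (enum_val_nth (u k)).
  move=> v0; apply/rowP => k; rewrite mxE; move: k; apply: v0.
  under eq_bigr do rewrite Xu.
  apply: val_inj; rewrite /= raddf_sum /=.
  under eq_bigr => k _.
    rewrite lM scaler_sumr.
    under eq_bigr do rewrite scalerA.
    over.
  rewrite exchange_big big1 //= => j _; rewrite -scaler_suml.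
  by have /rowP/(_ j) := vM0; rewrite !mxE => ->; rewrite scale0r.
pose t := [tuple \sum_j invmx M i j *: var j | i < n.+1].
pose t' := [tuple mpoly_of_dhomog (l (u k)) | k < n.+1].
have tX k : comp_mpoly t (l (u k)) = var k.
  rewrite lM raddf_sum /=.
  under eq_bigr => j _.
    rewrite comp_mpolyZ comp_mpolyXU -tnth_nth tnth_mktuple scaler_sumr.
    under eq_bigr do rewrite scalerA.
    over.
  rewrite exchange_big /= (bigD1 k) //= [X in _ + X]big1 => [|j jk].
    rewrite addr0 -scaler_suml; have /matrixP/(_ k k) := mulmxV Minv.
    by rewrite !mxE eqxx => ->; rewrite scale1r.
  rewrite -scaler_suml; have /matrixP/(_ k j) := mulmxV Minv.
  by rewrite !mxE eq_sym (negPf jk) => ->; rewrite scale0r.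
have t'X i : comp_mpoly t' (tnth t i) = var i.
  rewrite tnth_mktuple raddf_sum /=.
  under eq_bigr => j _.
    rewrite comp_mpolyZ comp_mpolyXU -tnth_nth tnth_mktuple lM scaler_sumr.
    under eq_bigr do rewrite scalerA.
    over.
  rewrite exchange_big /= (bigD1 i) //= [X in _ + X]big1 => [|j ji].
    rewrite addr0 -scaler_suml; have /matrixP/(_ i i) := mulVmx Minv.
    by rewrite !mxE eqxx => ->; rewrite scale1r.
  rewrite -scaler_suml; have /matrixP/(_ i j) := mulVmx Minv.
  by rewrite !mxE eq_sym (negPf ji) => ->; rewrite scale0r.
exists u, (comp_mpoly t : {rmorphism R -> R}); split=> //.
- by move=> i j /enum_val_inj/cast_ord_inj.
- move=> i; apply/idP/existsP => [iU|[k /eqP <-]]; last exact: enum_valP.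
  exists (cast_ord cU (enum_rank_in iU i)).
  by rewrite /u cast_ordK enum_rankK_in.
move=> f /=; rewrite [comp_mpoly t f]comp_mpolyE raddf_sum /= {1}[f]mpolyE.
apply: eq_bigr => e _; rewrite linearZ /=; congr (_ *: _).
rewrite mpolyXE_id rmorph_prod; apply: eq_bigr => i _.
by rewrite rmorphXn /= t'X.
Qed.

(** In coordinates where the relevant forms are variables, membership in
    [(l_J)^k + (l_T)] can be tested monomial by monomial, and multiplication by
    [l i] just shifts the monomials. *)
Lemma generic_regular s (l : 'I_s -> dhomog n.+1 K 1) :
  (n.+1 <= s)%N -> generic_forms l ->
  regular_upto (fun i => mpoly_of_dhomog (l i)) n.
Proof.
move=> ns gen_l T J i k g TJn iT.
(* Complete the indices involved to a set [U] of [n + 1] indices. *)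
have [||U [TJU _] cU] := @set_interpolation _ (i |: (T :|: J)) [set: 'I_s] n.+1.
- by apply/fintype.subsetP => j; rewrite !inE.
- rewrite cardsT card_ord ns andbT (leq_trans (leq_card_setU _ _)) // cards1.
  by rewrite add1n ltnS (leq_trans (leq_card_setU _ _)).
have [u [psi [u_inj uU psiX psiK]]] := linear_coordinates gen_l cU.
have TU : T \subset U.
  by apply: fintype.subset_trans TJU; rewrite -finset.setUCA finset.subsetUl.
have JU : J \subset U.
  by apply: fintype.subset_trans TJU; rewrite finset.setUA finset.subsetUr.
have [i' ui'] : exists i', u i' = i.
  move/fintype.subsetP: TJU => /(_ i (finset.setU11 _ _)).
  by rewrite uU => /existsP[k' /eqP]; exists k'.
(* [W e B] plays for monomials the role of [weight a B]; [restr] and [ext]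
   translate between exponents of the forms and of the variables. *)
pose W (e : multinom n.+1) (B : {set 'I_s}) := (\sum_(j | u j \in B) e j)%N.
pose lp a := lpow (fun i => mpoly_of_dhomog (l i)) a.
pose restr a := Multinom [tuple a (u j) | j < n.+1].
pose ext (e : multinom n.+1) (i : 'I_s) := (\sum_(j | u j == i) e j)%N.
pose v i := odflt ord0 [pick j | u j == i].
have uK : cancel u v.
  by move=> j; rewrite /v; case: pickP => [j' /eqP/u_inj//|/(_ j)]; rewrite eqxx.
have vK j : j \in U -> u (v j) = j.
  by rewrite uU => /existsP[j' /eqP <-]; rewrite uK.
have psi_lpow a : exists p, psi (lp a) = p * mpolyX K (restr a).
  rewrite /lp /lpow (bigID (fun j => j \in U)) /= mulrC rmorphM /=.
  set q := psi (\prod_(j | j \notin U) _); exists q; congr (_ * _).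
  rewrite (reindex_onto u v) //= mpolyXE_id rmorph_prod.
  apply: eq_big => [j|j _]; last by rewrite rmorphXn /= psiX mnmE.
  by rewrite uK eqxx uU andbT; apply/existsP; exists j.
have W_restr a (B : {set 'I_s}) : B \subset U -> W (restr a) B = weight a B.
  move=> /fintype.subsetP BU; rewrite /weight (reindex_onto u v) /=.
    by apply: eq_big => [j|j _]; rewrite ?uK ?eqxx ?andbT // mnmE.
  by move=> j /BU /vK.
have lpow_ext e : lp (ext e) = \prod_j mpoly_of_dhomog (l (u j)) ^+ e j.
  rewrite /lp /lpow; under eq_bigr do rewrite -prodrXr.
  rewrite (exchange_big_dep xpredT) //=; apply: eq_bigr => j _.
  by rewrite (bigD1 (u j)) //= big1 ?mulr1 // => j' /andP[/eqP->]; rewrite eqxx.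
have weight_ext e B : weight (ext e) B = W e B.
  rewrite /weight /ext (exchange_big_dep (fun j => u j \in B)) /=; last first.
    by move=> j j' jB /eqP ->.
  apply: eq_bigr => j uj; rewrite (bigD1 (u j)) ?uj ?eqxx //= big1 ?addn0 //.
  by move=> j' /andP[/andP[_ /eqP->]]; rewrite eqxx.
have WD e1 e2 B : W (mnm_add e1 e2) B = (W e1 B + W e2 B)%N.
  by rewrite -big_split; apply: eq_bigr => j _; rewrite mnmDE.
have W1 B : W (mnm1 i') B = (i \in B).
  rewrite -ui' /W; case: (boolP (u i' \in B)) => iB.
    rewrite (bigD1 i') //= mnm1E eqxx big1 // => j /andP[_ /negPf ji].
    by rewrite mnm1E eq_sym ji.
  by rewrite big1 // => j jB; rewrite mnm1E; case: eqP iB => // ->; rewrite jB.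
have supp f : gen (fun i => mpoly_of_dhomog (l i))
      (fun a => (k <= weight a J)%N \/ (0 < weight a T)%N) f ->
    forall e, e \in msupp (psi f) -> (k <= W e J)%N \/ (0 < W e T)%N.
  move: f; apply: gen_ind => [|f1 f2 IH1 IH2 e|f a aQ e].
  - by rewrite rmorph0 msupp0.
  - rewrite rmorphD => /msuppD_le; rewrite mem_cat => /orP[]; auto.
  have [p pE] := psi_lpow a; rewrite rmorphM /= pE mulrA.
  rewrite (perm_mem (msuppMX _ _)) => /mapP[e' _ ->].
  by rewrite !WD !W_restr //; lia.
move=> /supp {}supp; rewrite [g]psiK comp_mpolyE.
rewrite big_seq; apply: ideal_span_sum => e eg; rewrite -mul_mpolyC.
apply: ideal_spanM; under eq_bigr do rewrite tnth_mktuple.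
rewrite -lpow_ext; apply: gen_lpow; rewrite !weight_ext.
have := supp (mnm_add (mnm1 i') e); rewrite !WD !W1 (negPf iT) addnC; apply.
rewrite rmorphM /= -ui' psiX mulrC (perm_mem (msuppMX _ _)).
by apply/mapP; exists e.
Qed.

End Coordinates.

(** * Exponent vectors *)

(** The average over [T] is at least the average over the [c] smallest
    entries.  The induction on [#|T|] averages the bounds obtained by deleting
    one element of [T]. *)
Lemma weight_average (I : finType) (a : I -> nat) (c m : nat) (T : {set I}) :
    (0 < c <= #|T|)%N ->
    (forall J : {set I}, J \subset T -> #|J| = c -> (m <= weight a J)%N) ->
  (#|T| * m <= c * weight a T)%N.
Proof.
case/andP=> c_gt0; have [t] := ubnP #|T|; elim: t T => // t IHt T tT.
rewrite leq_eqVlt => /orP[/eqP cT aT|cT aT].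
  by rewrite -cT leq_mul2l aT ?orbT.
have step x : x \in T -> (#|T|.-1 * m + c * a x <= c * weight a T)%N.
  move=> xT; have cTx := cardsD1 x T; rewrite xT add1n in cTx.
  rewrite (weightD1 a xT) mulnDr addnC leq_add2l cTx /=.
  apply: IHt => [||J JT]; [lia|lia|].
  by apply: aT; apply: fintype.subset_trans JT (finset.subsetDl _ _).
have : (\sum_(x in T) (#|T|.-1 * m + c * a x)
        <= \sum_(x in T) c * weight a T)%N.
  exact: leq_sum.
rewrite big_split !sum_nat_const /= -(big_distrr c) -/(weight a T) /=.
have [p p_gt0 ->] : exists2 p, (0 < p)%N & #|T| = p.+1.
  by exists #|T|.-1; lia.
by move=> le_sum; rewrite -(leq_pmul2l p_gt0); move: le_sum => /=; nia.
Qed.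

(** Truncating [a] at [r] gives the row sums of a zero-one matrix with [r]
    columns; if the total is at least [r d], each column can be made to contain
    [d] ones.  One column [D] is split off at a time.  If at most [d] of the
    [a i] are at least [r], then [D] contains all these indices, so that passing
    to [r - 1] lowers the total by exactly [d].  Otherwise [D] consists of such
    indices, and these alone leave a total of [(r - 1) d]. *)
Lemma lpow_ideal_pow (A : comNzRingType) (I : finType) (l : I -> A) (S : set A)
    (d r : nat) (a : I -> nat) :
    (forall D : {set I}, #|D| = d -> S (\prod_(i in D) l i)) ->
    (r * d <= \sum_i minn (a i) r)%N ->
  ideal_pow S r (lpow l a).
Proof.
move=> Sd; elim: r a => [|r IHr] a rd; first exact: ideal_pow0.
pose B := [set i | (r < a i)%N]%SET; pose C := [set i | (0 < a i)%N]%SET.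
have rC : (r.+1 * d <= r.+1 * #|C|)%N.
  apply: leq_trans rd _; rewrite mulnC -sum_nat_const big_mkcond.
  rewrite [leqRHS]big_mkcond; apply: leq_sum => i _; rewrite inE.
  by case: posnP => [->|_]; rewrite ?min0n ?geq_minr.
rewrite leq_pmul2l // in rC.
have [D [cD DC rdD]] : exists D : {set I}, [/\ #|D| = d, D \subset C
    & (r * d <= \sum_i minn (a i - (i \in D)) r)%N].
  case: (leqP d #|B|) => dB.
    have [||D [_ DB] cD] := @set_interpolation _ finset.set0 B d.
    - by rewrite finset.sub0set.
    - by rewrite cards0.
    exists D; split=> //.
      apply: fintype.subset_trans DB _; apply/fintype.subsetP => i; rewrite !inE.
      by apply: leq_ltn_trans.
    rewrite -cD mulnC -sum_nat_const big_mkcond; apply: leq_sum => i _.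
    case: ifP => // iD; move/fintype.subsetP: DB => /(_ i iD); rewrite inE; lia.
  have [||D [BD DC] cD] := @set_interpolation _ B C d.
  - by apply/fintype.subsetP => i; rewrite !inE; apply: leq_ltn_trans.
  - by rewrite (ltnW dB) rC.
  exists D; split=> //; rewrite -(leq_add2l d) -mulSn; apply: leq_trans rd _.
  rewrite -{1}cD -sum1_card [X in (X + _)%N]big_mkcond -big_split /=.
  apply: leq_sum => i _; move/fintype.subsetP: BD => /(_ i); rewrite inE.
  by case: ifP => iD; lia.
have -> : lpow l a = \prod_(i in D) l i * lpow l (fun i => a i - (i \in D))%N.
  rewrite -lpow_set -lpowD; apply: eq_bigr => i _; congr (_ ^+ _).
  by move/fintype.subsetP: DC => /(_ i); rewrite inE; case: (i \in D) => /=; lia.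
by apply: ideal_powS; [exact: Sd|exact: IHr].
Qed.

(** Let [T] be the set of indices with [a i < r].  If [#|T| < c], the other
    indices already contribute [r] for at least [s - c + 1] of them.
    Otherwise the average of [a] on [T] is at least [m / c], and
    [m / c >= r (1 - (c - 1) / s) >= r (1 - (c - 1) / #|T|)]. *)
Lemma symbolic_exponent_bound (s c m r : nat) (a : 'I_s -> nat) :
    (0 < c <= s)%N -> (r * (c * (s - c).+1) <= m * s)%N ->
    (forall J : {set 'I_s}, #|J| = c -> (m <= weight a J)%N) ->
  (r * (s - c).+1 <= \sum_i minn (a i) r)%N.
Proof.
move=> /andP[c_gt0 cs] rm aJ.
pose T := [set i | (a i < r)%N]%SET.
have sT : (#|T| + #|~: T| = s)%N by rewrite cardsC card_ord.
have -> : (\sum_i minn (a i) r = weight a T + #|~: T| * r)%N.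
  rewrite (bigID (mem T)) /=; congr (_ + _)%N.
    by apply: eq_bigr => i; rewrite inE => ?; lia.
  rewrite -sum_nat_const; apply: eq_big => [i|i]; rewrite !inE // => ?; lia.
have [Tc|cT] := ltnP #|T| c.
  by rewrite mulnC; apply: leq_trans (leq_addl _ _); rewrite leq_mul2r; lia.
have avg : (#|T| * m <= c * weight a T)%N.
  by apply: weight_average => [|J _]; [rewrite c_gt0 cT|exact: aJ].
have : (#|T| * (r * (s - c).+1) <= s * weight a T)%N.
  rewrite -(leq_pmul2l c_gt0); nia.
move=> wT; have s_gt0 : (0 < s)%N by lia.
rewrite -(leq_pmul2l s_gt0) mulnDr -{1}sT mulnDl leq_add //.
have -> : (s * (#|~: T| * r) = #|~: T| * (r * s))%N by lia.
by rewrite !leq_mul2l; apply/orP; right; apply/orP; right; lia.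
Qed.

(** * Order of vanishing at the origin *)

Section OrderOfVanishing.
Variables (K : fieldType) (n : nat).
Local Notation R := (mpoly n.+1 K).
Implicit Types (f g : R) (d : nat).

Definition order_ge d f : Prop := forall e, e \in msupp f -> (d <= mdeg e)%N.

Lemma order_ge0 d : order_ge d 0.
Proof. by move=> e; rewrite msupp0. Qed.

Lemma order_geD d f g : order_ge d f -> order_ge d g -> order_ge d (f + g).
Proof. by move=> df dg e /msuppD_le; rewrite mem_cat => /orP[/df|/dg]. Qed.

Lemma order_geM d1 d2 f g :
  order_ge d1 f -> order_ge d2 g -> order_ge (d1 + d2) (f * g).
Proof.
move=> df dg e /msuppM_le/allpairsP[[e1 e2] /= [/df d1e /dg d2e ->]].
by rewrite mdegD leq_add.
Qed.

Lemma order_ge_ideal_span d (S : set R) :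
  (forall f, S f -> order_ge d f) -> forall f, ideal_span S f -> order_ge d f.
Proof.
move=> Sd; apply: ideal_span_ind; [exact: order_ge0| |].
  by move=> *; exact: order_geD.
by move=> f g /Sd gd; rewrite -[d]add0n; apply: order_geM.
Qed.

Lemma order_ge_ideal_pow d r (S : set R) :
    (forall f, S f -> order_ge d f) ->
  forall f, ideal_pow S r f -> order_ge (r * d) f.
Proof.
move=> Sd; apply: order_ge_ideal_span => _ [g [Sg ->]].
elim: r g Sg => [|r IHr] g Sg; first by [].
by rewrite big_ord_recl mulSn; apply: order_geM; [apply: Sd|apply: IHr].
Qed.

Variables (s : nat) (l : 'I_s -> dhomog n.+1 K 1).
Local Notation L := (fun i => mpoly_of_dhomog (l i)).

Lemma lpow_homog (a : 'I_s -> nat) :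
  lpow L a \is ishomog1 (\sum_i a i) (@mdeg n.+1).
Proof.
rewrite /lpow; elim/big_rec2: _ => [|i f d _ fd]; first exact: dhomog1.
apply: dhomogM => //.
by have := dhomogMn (a i) (dhomog_is_dhomog (l i)); rewrite mul1n.
Qed.

Lemma order_ge_lpow d (a : 'I_s -> nat) :
  (d <= \sum_i a i)%N -> order_ge d (lpow L a).
Proof. by move=> da e /(dhomog_mf (lpow_homog a)) /= ->. Qed.

End OrderOfVanishing.

(** * Star configurations *)

Section StarIdeals.
Variables (K : fieldType) (n s : nat) (l : 'I_s -> dhomog n.+1 K 1).
Local Notation R := (mpoly n.+1 K).
Local Notation L := (fun i => mpoly_of_dhomog (l i)).

Lemma forms_ideal_gen (J : {set 'I_s}) f :
  forms_ideal l J f -> gen L (fun a => 1 <= weight a J)%N f.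
Proof.
move: f; apply: ideal_span_ind; [exact: ideal_span0|exact: ideal_spanD|].
move=> f _ [j jJ <-]; apply: ideal_spanM; rewrite -(lpow_one_at L j).
by apply: gen_lpow; rewrite weight_one_at jJ.
Qed.

Lemma forms_ideal_pow_gen (J : {set 'I_s}) m f :
  ideal_pow (forms_ideal l J) m f -> gen L (fun a => m <= weight a J)%N f.
Proof.
move: f; apply: ideal_span_ind; [exact: ideal_span0|exact: ideal_spanD|].
move=> f _ [g [Jg ->]]; apply: ideal_spanM.
elim: m g Jg => [|m IHm] g Jg; first exact: gen_full.
rewrite big_ord_recl; apply: genM (forms_ideal_gen (Jg _)) (IHm _ _) => //.
by move=> a b a1 bm; rewrite weightD; lia.
Qed.

Lemma lpow_forms_ideal_pow (J : {set 'I_s}) m a :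
  (m <= weight a J)%N -> ideal_pow (forms_ideal l J) m (lpow L a).
Proof.
elim: m a => [|m IHm] a am; first exact: ideal_pow0.
have [i iJ ai] := weight_gt0 (leq_trans (ltn0Sn m) am).
rewrite (lpow_sub L ai); apply: ideal_powS.
  by apply: ideal_span_mem; exists i.
apply: IHm; rewrite -ltnS; apply: leq_trans am _.
suff -> : weight a J
  = (weight (one_at i) J + weight (fun j => a j - one_at i j) J)%N.
  by rewrite weight_one_at iJ.
rewrite -weightD; apply: eq_bigr => j _.
by rewrite /one_at; case: eqP => [->|_]; lia.
Qed.

Hypotheses (ns : (n.+1 <= s)%N) (gen_l : generic_forms l).
Variable c : nat.
Hypothesis c_bounds : (1 <= c <= n)%N.

Lemma generic_gen_star m f :
    (forall J : {set 'I_s}, #|J| = c -> gen L (fun a => m <= weight a J)%N f) ->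
  gen L (fun a => forall J : {set 'I_s}, #|J| = c -> (m <= weight a J)%N) f.
Proof.
move=> fJ.
have zero J : weight (fun _ : 'I_s => 0%N) J = 0%N by apply: big1.
have := @gen_star _ _ L n c finset.set0 m (fun _ => 0%N) f
  (generic_regular ns gen_l).
rewrite cards0 => star_cap; apply: gen_sub (star_cap _ _).
- move=> a [aJ J cJ|]; last by rewrite weight_set0.
  have := aJ J cJ; rewrite zero addn0; apply.
  by rewrite -setI_eq0 finset.setI0.
- by case/andP: c_bounds.
by move=> J cJ _; apply: gen_sub (fJ J cJ) => a; rewrite zero addn0; left.
Qed.

Lemma star_symbolic_power_gen m f : star_symbolic_power l c m f ->
  gen L (fun a => forall J : {set 'I_s}, #|J| = c -> (m <= weight a J)%N) f.
Proof.
by move=> fc; apply: generic_gen_star => J cJ; apply: forms_ideal_pow_gen; apply: fc.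
Qed.

(** A product that lies in [I] involves at least [s - c + 1] of the forms, as
    the indices that it misses cannot contain a set of size [c]. *)
Lemma star_ideal_order f : star_ideal l c f -> order_ge (s - c).+1 f.
Proof.
move=> fc; have /generic_gen_star : forall J : {set 'I_s}, #|J| = c ->
    gen L (fun a => 1 <= weight a J)%N f.
  by move=> J cJ; apply: forms_ideal_gen; apply: fc.
move: f {fc}; apply: order_ge_ideal_span => _ [a aJ ->]; apply: order_ge_lpow.
pose Z := [set i | a i == 0%N]%SET.
have Zc : (#|Z| < c)%N.
  rewrite ltnNge; apply/negP => cZ.
  have [||J [_ JZ] cJ] := @set_interpolation _ finset.set0 Z c.
  - by rewrite finset.sub0set.
  - by rewrite cards0.
  have /weight_gt0[i iJ] := aJ J cJ.
  by move/fintype.subsetP: JZ => /(_ i iJ); rewrite inE => /eqP ->.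
apply: (@leq_trans #|~: Z|).
  by have := cardsC Z; rewrite card_ord; lia.
rewrite -sum1_card big_mkcond; apply: leq_sum => i _.
by rewrite !inE; case: (posnP (a i)).
Qed.

Lemma prod_in_star_ideal (D : {set 'I_s}) :
  #|D| = (s - c).+1 -> star_ideal l c (\prod_(i in D) L i).
Proof.
move=> cD J cJ.
have [i] : exists i, i \in D :&: J.
  apply/card_gt0P; rewrite -(ltn_add2l #|D :|: J|) addn0 cardsUI cD cJ.
  have : (#|D :|: J| <= s)%N by rewrite -[leqRHS]card_ord max_card.
  by move: c_bounds ns; lia.
rewrite inE => /andP[iD iJ]; rewrite (bigD1 i) //= mulrC.
by apply: ideal_spanM; apply: ideal_span_mem; exists i.
Qed.

Lemma star_containment m r : (r * (c * (s - c).+1) <= m * s)%N ->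
  (star_symbolic_power l c m `<=` ideal_pow (star_ideal l c) r)%classic.
Proof.
move=> rm f /star_symbolic_power_gen; move: f; apply: gen_ind.
- exact: ideal_span0.
- exact: ideal_spanD.
move=> f a aJ; apply: ideal_spanM.
apply: (@lpow_ideal_pow _ _ _ _ (s - c).+1); first exact: prod_in_star_ideal.
by apply: symbolic_exponent_bound aJ => //; move: c_bounds ns; lia.
Qed.

Lemma form_neq0 i : mpoly_of_dhomog (l i) != 0.
Proof.
have [||J [iJ _] cJ] := @set_interpolation _ [set i]%SET [set: 'I_s]%SET n.+1.
- exact: finset.subsetT.
- by rewrite cards1 cardsT card_ord.
have /free_not0 : free [seq l j | j <- enum J] by apply: gen_l.
move=> /(_ (l i)); rewrite map_f ?mem_enum -?finset.sub1set // => /(_ isT).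
by apply: contra => /eqP li0; apply/eqP/val_inj.
Qed.

(** The witness is the [k]-th power of the product of all the forms, which
    vanishes to order [c k] on each component. *)
Lemma star_noncontainment k r : (k * s < r * (s - c).+1)%N ->
  ~ (star_symbolic_power l c (c * k) `<=` ideal_pow (star_ideal l c) r)%classic.
Proof.
move=> kr /(_ (lpow L (fun _ => k))) sub.
have {}sub : ideal_pow (star_ideal l c) r (lpow L (fun _ => k)).
  apply: sub => J cJ; apply: lpow_forms_ideal_pow.
  by rewrite /weight sum_nat_const cJ.
have lk0 : lpow L (fun _ => k) != 0.
  by apply/prodf_neq0 => i _; rewrite expf_neq0 // form_neq0.
have e_supp := mlead_supp lk0.
have := order_ge_ideal_pow star_ideal_order sub e_supp.
rewrite (dhomog_mf (lpow_homog l _) e_supp) sum_nat_const card_ord; lia.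
Qed.

End StarIdeals.

(** * The resurgence *)

Theorem theorem3p6 (R : realType) (K : fieldType) (n s c : nat)
    (l : 'I_s -> dhomog n.+1 K 1) :
  (n.+1 <= s)%N -> generic_forms l -> (1 <= c <= n)%N ->
  star_resurgence l R c = (c%:R * (s%:R - c%:R + 1) / s%:R)%:E.
Proof.
move=> ns gen_l cn; have cs : (c <= s)%N by lia.
have s_gt0 : (0 < s%:R :> R) by rewrite ltr0n; lia.
have -> : s%:R - c%:R + 1 = (s - c).+1%:R :> R by rewrite -natr1 natrB.
set d := (s - c).+1; apply/eqP; rewrite eq_le; apply/andP; split.
  apply: ge_ereal_sup => _ [m [r [m_gt0 r_gt0 mr ->]]].
  rewrite lee_fin leNgt; apply/negP => lt_mr; apply: mr.
  apply: star_containment => //; rewrite -/d.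
  have r_gt0' : (0 < r%:R :> R) by rewrite ltr0n.
  move: lt_mr; rewrite ltr_pdivrMr // mulrAC ltr_pdivlMr // -!natrM ltr_nat; lia.
apply/lee_addgt0Pr => e e_gt0.
(* With [r = s N] and [k = d N - 1], the ratio [c k / r] falls short of
   [c d / s] by [c / (s N)]. *)
have se_gt0 : 0 < s%:R * e by rewrite mulr_gt0.
have [N N_gt1 c_le] : exists2 N, (1 < N)%N & c%:R <= s%:R * e * N%:R.
  exists (Num.truncn (c%:R / (s%:R * e))).+2 => //.
  rewrite mulrC -ler_pdivrMr //; apply: ltW; apply: lt_trans (truncnS_gt _) _.
  by rewrite ltr_nat.
pose r := (s * N)%N; pose k := (d * N).-1.
have dN : (d * N = k.+1)%N by rewrite prednK // muln_gt0; lia.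
have k_gt0 : (0 < k)%N by rewrite -ltnS -dN (leq_trans N_gt1) // leq_pmull.
have kr : (k * s < r * d)%N.
  by rewrite /r -mulnA [(N * d)%N]mulnC dN mulnC ltn_pmul2l //; lia.
apply: (@le_trans _ _ (((c * k)%:R / r%:R)%:E + e%:E)).
  have r_gt0 : (0 < r%:R :> R) by rewrite ltr0n muln_gt0; lia.
  have kE : (c * k)%:R = c%:R * d%:R * N%:R - c%:R :> R.
    by rewrite -mulrA -natrM dN -natr1 mulrDr mulr1 addrK natrM.
  rewrite -EFinD lee_fin -lerBlDr ler_pdivlMr // kE natrM mulrBl mulrA divfK.
    by rewrite lerD2l lerN2 mulrCA mulrA.
  by rewrite gt_eqF.
apply: leeD => //; apply: ereal_sup_ubound; exists (c * k)%N, r; split=> //.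
- by rewrite muln_gt0 k_gt0 andbT; lia.
- by rewrite muln_gt0; lia.
exact: star_noncontainment.
Qed.
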